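(* Let $f_1,\dots,f_m$, $F$ and $\mathcal G$ satisfy the standing assumptions in the context. Let $W\in\mathcal W_{\mathcal G}\cap\mathbb S^m_{++}$ and $\mathbf L:=(I-W)^{1/2}$. Let $\{\alpha^k\}_{k\ge0}$, $\{\sigma^k\}_{k\ge0}$ be sequences of positive numbers, $\gamma^0=1$ and $\gamma^k=\alpha^k/\alpha^{k-1}$ for $k\ge1$. Given $\mathbf X^{-1},\mathbf X^0\in\mathbb R^{m\times d}$, $\mathbf D^0=\mathbf 0$ and $\mathbf Y^0=\mathbf 0$, let, for $k=0,1,2,\dots$, $$\mathbf D^{k+1}=\mathbf D^k+\sigma^k\alpha^k(I-W)\big((1+\gamma^k)\mathbf X^k-\gamma^k\mathbf X^{k-1}\big),\qquad \mathbf X^{k+1}=\mathbf X^k-\alpha^k\big(\nabla F(\mathbf X^k)+\mathbf D^{k+1}\big),$$ $$\mathbf Y^{k+1}=\mathbf Y^k+\sigma^k\alpha^k\big((1+\gamma^k)\mathbf L\mathbf X^k-\gamma^k\mathbf L\mathbf X^{k-1}\big).$$ Then for any given saddle point $(\mathbf X^*,\mathbf Y^* )$ of $\mathcal L(\mathbf X,\mathbf Y)=F(\mathbf X)+\langle\mathbf L\mathbf X,\mathbf Y\rangle$ and any $\zeta^k>0$, the quantity $$V^k_\star:=\|\mathbf X^k-\mathbf X^*\|^2+\frac1{\sigma^k}\|\mathbf Y^k-\mathbf Y^*\|^2+\frac12\|\mathbf X^k-\mathbf X^{k-1}\|^2+2\gamma^k\alpha^k\Delta\mathcal L_\star^{k-1}$$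 satisfies, for all $k\ge0$, $$\begin{aligned}V^{k+1}_\star\le{}&V^k_\star-\Big(\tfrac12-\alpha^kL^k-\alpha^k\zeta^k\Big)\|\mathbf X^{k+1}-\mathbf X^k\|^2-\Big(\tfrac12-\alpha^kL^k\Big)\|\mathbf X^k-\mathbf X^{k-1}\|^2\\&-\Big(\tfrac1{\sigma^k}-\tfrac{\alpha^k}{\zeta^k}\Big)\|\mathbf Y^{k+1}-\mathbf Y^k\|^2-\frac{\sigma^{k+1}-\sigma^k}{\sigma^k\sigma^{k+1}}\|\mathbf Y^{k+1}-\mathbf Y^*\|^2\\&-\big[(2+2\gamma^k)\alpha^k-2\gamma^{k+1}\alpha^{k+1}\big]\Delta\mathcal L_\star^k,\end{aligned}$$ where $$L^k:=\frac{\|\nabla F(\mathbf X^k)-\nabla F(\mathbf X^{k-1})\|}{\|\mathbf X^k-\mathbf X^{k-1}\|}$$ (with $L^k:=0$ if $\mathbf X^k=\mathbf X^{k-1}$).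
   Context: There are $m$ agents. Each $f_i:\mathbb R^d\to\mathbb R$ ($i=1,\dots,m$) is continuously differentiable, locally smooth (its gradient is locally Lipschitz), and $\mu$-strongly convex with $\mu\in[0,\infty)$ ($\mu=0$ means merely convex); if $\mu=0$, $f=\frac1m\sum_i f_i$ has a minimizer over $\mathbb R^d$. For $\mathbf X=[x_1,\dots,x_m]^\top\in\mathbb R^{m\times d}$, $F(\mathbf X):=\sum_{i=1}^m f_i(x_i)$, and $\nabla F(\mathbf X)$ is the $m\times d$ matrix with rows $\nabla f_i(x_i)^\top$. $\|\cdot\|$ and $\langle\cdot,\cdot\rangle$ on matrices are the Frobenius norm and inner product. $\mathcal G=(\mathcal V,\mathcal E)$, $\mathcal V=\{1,\dots,m\}$, is an undirected connected graph. $\mathcal W_{\mathcal G}$ is the set of symmetric doubly stochastic matrices $\widetilde W=(\widetilde w_{ij})$ with $\widetilde w_{ii}>0$ for all $i$, $\widetilde w_{ij}>0$ for $(i,j)\in\mathcal E$, and $\widetilde w_{ij}=0$ otherwise. $\mathbb S^m_{++}$ is the set of real symmetric positive definite $m\times m$ matrices. A saddle point $(\mathbf X^*,\mathbf Y^* )$ of $\mathcal L$ satisfies $\mathcal L(\mathbf X^*,\mathbf Y)\le\mathcal L(\mathbf X^*,\mathbf Y^* )\le\mathcal L(\mathbf X,\mathbf Y^* )$ for all $\mathbf X,\mathbf Y\in\mathbb R^{m\times d}$. The primal gap is $\Delta\mathcal L_\star^k:=\mathcal L(\mathbf X^k,\mathbf Y^* )-\mathcal L(\mathbf X^*,\mathbf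 Y^* )=F(\mathbf X^k)-F(\mathbf X^* )+\langle\mathbf L\mathbf Y^*,\mathbf X^k-\mathbf X^*\rangle\ge0$ (defined for $k\ge-1$).
   Formalization: For k=0 only, the formal statement additionally assumes X^0 = X^{-1} − α^0(∇F(X^{-1}) + D^0); with arbitrary X^{-1}, X^0 the inequality fails at k=0 (e.g. m=d=1, f=x²/2, W=1, α=σ=1, ζ=1/2, X^{-1}=X^0=1). All k≥1 are as stated. *)

(* Defs.v *)
From HB Require Import structures.
From mathcomp Require Import all_boot all_order all_algebra.
From mathcomp Require Import all_classical all_reals all_analysis.

Set Implicit Arguments.
Unset Strict Implicit.
Unset Printing Implicit Defensive.

Import Order.TTheory GRing.Theory Num.Theory.
Import numFieldNormedType.Exports.

Local Open Scope classical_set_scope.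
Local Open Scope ring_scope.

(* The library norm on matrices is the sup norm, hence the explicit Frobenius
   inner product and norm; on row vectors they are the Euclidean ones. *)
Definition fdot (R : realType) (m n : nat) (A B : 'M[R]_(m, n)) : R :=
  \sum_i \sum_j A i j * B i j.

Definition fnorm (R : realType) (m n : nat) (A : 'M[R]_(m, n)) : R :=
  Num.sqrt (fdot A A).

Definition gradient (R : realType) (d : nat) (f : 'rV[R]_d -> R)
    (x : 'rV[R]_d) : 'rV[R]_d :=
  \row_(j < d) 'D_(delta_mx 0 j) f x.

Definition continuously_differentiable (R : realType) (d : nat)
    (f : 'rV[R]_d -> R) : Prop :=
  (forall x, differentiable f x) /\ continuous (gradient f).

(* The Lipschitz condition is relative to the sup norm; in finite dimension this
   changes the local constants only. *)
Definition locally_smooth (R : realType) (d : nat) (f : 'rV[R]_d -> R) : Prop :=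
  [locally [lipschitz gradient f x | x in setT]].

Definition strongly_convex (R : realType) (d : nat) (mu : R)
    (f : 'rV[R]_d -> R) : Prop :=
  forall (x y : 'rV[R]_d) (t : R), 0 <= t <= 1 ->
    f (t *: x + (1 - t) *: y) <=
      t * f x + (1 - t) * f y - mu / 2 * t * (1 - t) * fnorm (x - y) ^+ 2.

Definition is_minimizer (R : realType) (d : nat) (f : 'rV[R]_d -> R)
    (x : 'rV[R]_d) : Prop :=
  forall y, f x <= f y.

Definition average (R : realType) (m d : nat) (f : 'I_m -> 'rV[R]_d -> R)
    (x : 'rV[R]_d) : R :=
  m%:R^-1 * \sum_i f i x.

Definition stackF (R : realType) (m d : nat) (f : 'I_m -> 'rV[R]_d -> R)
    (X : 'M[R]_(m, d)) : R :=
  \sum_i f i (row i X).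

Definition grad_stackF (R : realType) (m d : nat) (f : 'I_m -> 'rV[R]_d -> R)
    (X : 'M[R]_(m, d)) : 'M[R]_(m, d) :=
  \matrix_(i, j) gradient (f i) (row i X) 0 j.

Definition undirected_connected (m : nat) (e : rel 'I_m) : Prop :=
  symmetric e /\ forall i j, connect e i j.

Definition doubly_stochastic (R : realType) (m : nat) (W : 'M[R]_m) : Prop :=
  [/\ forall i j, 0 <= W i j,
      forall i, \sum_j W i j = 1 &
      forall j, \sum_i W i j = 1].

Definition gossip_matrix (R : realType) (m : nat) (e : rel 'I_m)
    (W : 'M[R]_m) : Prop :=
  [/\ W^T = W,
      doubly_stochastic W,
      forall i, 0 < W i i,
      forall i j, e i j -> 0 < W i j &
      forall i j, i != j -> ~~ e i j -> W i j = 0].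

Definition pos_def (R : realType) (m : nat) (A : 'M[R]_m) : Prop :=
  A^T = A /\ forall x : 'cV[R]_m, x != 0 -> 0 < (x^T *m A *m x) 0 0.

Definition pos_semidef (R : realType) (m : nat) (A : 'M[R]_m) : Prop :=
  A^T = A /\ forall x : 'cV[R]_m, 0 <= (x^T *m A *m x) 0 0.

(* [B] is the principal square root of [A]: a positive semidefinite [A] has
   exactly one positive semidefinite square root. *)
Definition is_sqrt_mx (R : realType) (m : nat) (A B : 'M[R]_m) : Prop :=
  pos_semidef B /\ B *m B = A.

Definition lagrangian (R : realType) (m d : nat) (f : 'I_m -> 'rV[R]_d -> R)
    (L : 'M[R]_m) (X Y : 'M[R]_(m, d)) : R :=
  stackF f X + fdot (L *m X) Y.

Definition saddle_point (R : realType) (m d : nat)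
    (Lag : 'M[R]_(m, d) -> 'M[R]_(m, d) -> R) (Xs Ys : 'M[R]_(m, d)) : Prop :=
  forall X Y, Lag Xs Y <= Lag Xs Ys /\ Lag Xs Ys <= Lag X Ys.

(* A sequence indexed by k >= -1 is given by its term [xm1] of index -1 and the
   terms [x k], k >= 0; [lagged xm1 x k] is the term of index k - 1. *)
Definition lagged (T : Type) (xm1 : T) (x : nat -> T) (k : nat) : T :=
  if k is k'.+1 then x k' else xm1.

Definition stepsize_ratio (R : realType) (alpha : nat -> R) (k : nat) : R :=
  if k is k'.+1 then alpha k / alpha k' else 1.

Definition local_lipschitz_estimate (R : realType) (m d : nat)
    (f : 'I_m -> 'rV[R]_d -> R) (Z Z' : 'M[R]_(m, d)) : R :=
  if Z == Z' then 0
  else fnorm (grad_stackF f Z - grad_stackF f Z') / fnorm (Z - Z').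

Definition primal_gap (R : realType) (m d : nat) (f : 'I_m -> 'rV[R]_d -> R)
    (L : 'M[R]_m) (Xs Ys X : 'M[R]_(m, d)) : R :=
  lagrangian f L X Ys - lagrangian f L Xs Ys.

(* Main.v *)
(* Since L^2 = I - W, one has D^k = L Y^k, so that the primal updates read
   X^{k+1} - X^k = - alpha^k (grad F(X^k) + L Y^{k+1}) and
   gamma^k (X^k - X^{k-1}) = - alpha^k (grad F(X^{k-1}) + L Y^k);
   at k = 0 the latter is the assumption on X^{-1}, X^0.  Expanding
   |X^{k+1} - X^*|^2 and |Y^{k+1} - Y^*|^2 with these relations and L X^* = 0
   gives an exact identity.  In it, the products of grad F(X^k) + L Y^* with
   X^k - X^* and X^k - X^{k-1} are bounded by gaps through convexity, and the
   cross terms of X^{k+1} - X^k with grad F(X^k) - grad F(X^{k-1}) and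
   L (Y^{k+1} - Y^k) by Young's inequality, using L^2 <= I because W is
   positive definite. *)
Require Import Defs.
From HB Require Import structures.
From mathcomp Require Import all_boot all_order all_algebra.
From mathcomp Require Import all_classical all_reals all_analysis.
From mathcomp Require Import ring lra.
Import Order.TTheory GRing.Theory Num.Theory.
Import numFieldNormedType.Exports.
Local Open Scope ring_scope.

Set Implicit Arguments.
Unset Strict Implicit.

(** * Bilinearity, adjoints and Young's inequality *)

Section FrobeniusProduct.
Variables (R : realType) (m d : nat).
Implicit Types (A B C : 'M[R]_(m, d)) (c : R).

Lemma fdotC A B : fdot A B = fdot B A.
Proof. by apply: eq_bigr => i _; apply: eq_bigr => j _; rewrite mulrC. Qed.

Lemma fdotDl A B C : fdot (A + B) C = fdot A C + fdot B C.
Proof.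
rewrite /fdot -big_split; apply: eq_bigr => i _.
by rewrite -big_split; apply: eq_bigr => j _; rewrite mxE mulrDl.
Qed.

Lemma fdotZl c A B : fdot (c *: A) B = c * fdot A B.
Proof.
rewrite /fdot mulr_sumr; apply: eq_bigr => i _.
by rewrite mulr_sumr; apply: eq_bigr => j _; rewrite mxE mulrA.
Qed.

Lemma fdotNl A B : fdot (- A) B = - fdot A B.
Proof. by rewrite -scaleN1r fdotZl mulN1r. Qed.

Lemma fdotDr A B C : fdot C (A + B) = fdot C A + fdot C B.
Proof. by rewrite fdotC fdotDl !(fdotC C). Qed.

Lemma fdotZr c A B : fdot A (c *: B) = c * fdot A B.
Proof. by rewrite fdotC fdotZl fdotC. Qed.

Lemma fdotNr A B : fdot A (- B) = - fdot A B.
Proof. by rewrite fdotC fdotNl fdotC. Qed.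

Lemma fdotBr A B C : fdot C (A - B) = fdot C A - fdot C B.
Proof. by rewrite fdotDr fdotNr. Qed.

Lemma fdot0r A : fdot A 0 = 0.
Proof. by rewrite -(scale0r 0) fdotZr mul0r. Qed.

Lemma fdot_ge0 A : 0 <= fdot A A.
Proof. by apply: sumr_ge0 => i _; apply: sumr_ge0 => j _; apply: sqr_ge0. Qed.

Lemma fnorm_sqr A : fnorm A ^+ 2 = fdot A A.
Proof. by rewrite sqr_sqrtr ?fdot_ge0. Qed.

Lemma fdot_eq0 A : (fdot A A == 0) = (A == 0).
Proof.
apply/idP/eqP => [|->]; last exact/eqP/fdot0r.
rewrite psumr_eq0 => [/allP h|i _]; last first.
  by apply: sumr_ge0 => j _; apply: sqr_ge0.
apply/matrixP => i j; rewrite mxE; apply/eqP.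
have := h i (mem_index_enum i); rewrite implyTb psumr_eq0 => [/allP hi|j' _].
  by have := hi j (mem_index_enum j); rewrite implyTb mulf_eq0 orbb.
exact: sqr_ge0.
Qed.

Lemma fnorm_eq0 A : (fnorm A == 0) = (A == 0).
Proof. by rewrite -sqrf_eq0 fnorm_sqr fdot_eq0. Qed.

Lemma fdot_young c A B : 0 < c ->
  - (2 * fdot A B) <= c * fdot A A + c^-1 * fdot B B.
Proof.
move=> c0; rewrite -subr_ge0.
have -> : c * fdot A A + c^-1 * fdot B B - - (2 * fdot A B)
    = c^-1 * fdot (c *: A + B) (c *: A + B).
  rewrite !(fdotDl, fdotDr, fdotZl, fdotZr) (fdotC B A).
  by field; rewrite gt_eqF.
by rewrite mulr_ge0 ?fdot_ge0// invr_ge0 ltW.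
Qed.

Lemma fdot_mulmxl (L : 'M[R]_m) A B : fdot (L *m A) B = fdot A (L^T *m B).
Proof.
rewrite /fdot exchange_big [RHS]exchange_big; apply: eq_bigr => j _ /=.
transitivity (\sum_i \sum_k L i k * A k j * B i j).
  by apply: eq_bigr => i _; rewrite mxE mulr_suml.
rewrite exchange_big; apply: eq_bigr => k _; rewrite mxE mulr_sumr.
by apply: eq_bigr => i _; rewrite mxE mulrCA mulrA.
Qed.

(** The product splits into the quadratic forms of [W] at the columns of [A]; zero columns are
    treated apart because [pos_def] speaks of nonzero vectors. *)
Lemma pos_def_fdot_ge0 (W : 'M[R]_m) A : pos_def W -> 0 <= fdot A (W *m A).
Proof.
move=> [_ hW]; rewrite /fdot exchange_big; apply: sumr_ge0 => j _ /=.
have -> : \sum_i A i j * (W *m A) i j = ((col j A)^T *m W *m col j A) 0 0.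
  rewrite -mulmxA mxE; apply: eq_bigr => i _; rewrite !mxE; congr (_ * _).
  by apply: eq_bigr => k _; rewrite mxE.
have [->|/hW/ltW//] := eqVneq (col j A) 0.
by rewrite mulmx0 mxE.
Qed.

End FrobeniusProduct.

(** * First-order convexity inequality *)

Section Gradient.
Variables (R : realType) (d : nat) (f : 'rV[R]_d -> R).

Lemma derive_gradient x v : differentiable f x ->
  'D_v f x = \sum_j gradient f x 0 j * v 0 j.
Proof.
move=> df; rewrite deriveE// {1}(row_sum_delta v) linear_sum.
by apply: eq_bigr => j _; rewrite linearZ /= mxE deriveE// mulrC.
Qed.

(** For 0 < t <= 1 the difference quotient along [y - x] is already at most [f y - f x], the modulus
    term being nonnegative; let t tend to 0 from the right. *)
Lemma strongly_convex_derive_le mu x y : 0 <= mu -> strongly_convex mu f ->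
  differentiable f x -> 'D_(y - x) f x <= f y - f x.
Proof.
move=> mu0 hf df.
apply: (cvgr_to_le (cvg_dnbhs_at_right (@diff_derivable _ _ _ _ _ (y - x) df))).
near=> t.
have t0 : 0 < t by near: t; exact: nbhs_right_gt.
have t1 : t <= 1 by near: t; exact: nbhs_right_le.
have /(hf y x t) : 0 <= t <= 1 by rewrite ltW.
have -> : t *: y + (1 - t) *: x = t *: (y - x) + x.
  by rewrite scalerBl scale1r scalerBr [x - _]addrC addrA.
have : 0 <= mu / 2 * t * (1 - t) * fnorm (y - x) ^+ 2.
  by rewrite !mulr_ge0 ?sqrtr_ge0 ?invr_ge0 ?ler0n ?subr_ge0 ?(ltW t0).
rewrite /= ler_pdivrMl// => ? ?; lra.
Unshelve. all: by end_near. Qed.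

End Gradient.

(** * Stacked objective, local Lipschitz estimate and primal gap *)

Section Stacking.
Variables (R : realType) (m d : nat) (f : 'I_m -> 'rV[R]_d -> R).
Implicit Types X Y : 'M[R]_(m, d).

Lemma stackF_subgradient mu X Y : 0 <= mu ->
  (forall i, strongly_convex mu (f i)) ->
  (forall i, differentiable (f i) (row i X)) ->
  fdot (grad_stackF f X) (Y - X) <= stackF f Y - stackF f X.
Proof.
move=> mu0 hf df; rewrite /stackF -sumrB; apply: ler_sum => i _.
apply: le_trans (strongly_convex_derive_le _ mu0 (hf i) (df i)).
by rewrite derive_gradient//; apply/ler_sum => j _; rewrite !mxE.
Qed.

(* Young's inequality with weight [L^k] itself, so that no Cauchy-Schwarz is
   needed; [L^k = 0] means that the two gradients coincide. *)
Lemma local_lipschitz_young X X' U :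
  - (2 * fdot U (grad_stackF f X - grad_stackF f X')) <=
  local_lipschitz_estimate f X X' * (fdot U U + fdot (X - X') (X - X')).
Proof.
rewrite /local_lipschitz_estimate; case: eqVneq => [->|neX].
  by rewrite subrr fdot0r mulr0 oppr0 mul0r.
set g := _ - grad_stackF f X'.
have s0 : fnorm (X - X') != 0 by rewrite fnorm_eq0 subr_eq0.
have [g0|g0] := eqVneq g 0.
  by rewrite g0 /fnorm !fdot0r sqrtr0 mulr0 oppr0 !mul0r.
have gn0 : fnorm g != 0 by rewrite fnorm_eq0.
have c0 : 0 < fnorm g / fnorm (X - X').
  by rewrite divr_gt0// lt0r sqrtr_ge0 ?s0 ?gn0.
apply: le_trans (fdot_young U g c0) _.
rewrite -!fnorm_sqr le_eqVlt; apply/orP; left; apply/eqP.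
by field; rewrite s0 gn0.
Qed.

Lemma saddle_point_feasible (L : 'M[R]_m) Xs Ys :
  saddle_point (lagrangian f L) Xs Ys -> L *m Xs = 0.
Proof.
(* Moving the dual variable by [L *m Xs] raises the Lagrangian by |L Xs|^2, which dual optimality
   forbids unless it vanishes. *)
move=> /(_ Xs (Ys + L *m Xs)) [h _]; apply/eqP.
rewrite -fdot_eq0 eq_le fdot_ge0 andbT.
by move: h; rewrite /lagrangian fdotDr; lra.
Qed.

(** Up to a constant the gap is F plus the linear form of [L *m Ys], hence convex with gradient
    [grad_stackF f X + L *m Ys]. *)
Lemma primal_gap_subgradient mu (L : 'M[R]_m) Xs Ys X Z : 0 <= mu ->
  (forall i, strongly_convex mu (f i)) ->
  (forall i, differentiable (f i) (row i X)) -> L^T = L ->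
  primal_gap f L Xs Ys X - primal_gap f L Xs Ys Z <=
  fdot (grad_stackF f X + L *m Ys) (X - Z).
Proof.
move=> mu0 hf df Lsym; have := stackF_subgradient Z mu0 hf df.
rewrite /primal_gap /lagrangian fdotDl !fdotBr.
rewrite ![fdot (L *m Ys) _]fdotC ![fdot (L *m _) Ys]fdot_mulmxl Lsym; lra.
Qed.

End Stacking.

(* Here [p] is the iterate before [x], and [a], [g], [s], [G], [Gp] stand for
   [alpha], [gamma], [sigma] and the gradients at [x] and [p]. Subtracting the
   two primal relations leaves [G - Gp] and [L (y1 - y)] only. *)
Lemma primal_dual_step (R : realType) (m d : nat) (L : 'M[R]_m) (a g s : R)
    (x p x1 xs y y1 ys G Gp : 'M[R]_(m, d)) :
  0 < s -> L^T = L -> L *m xs = 0 ->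
  x1 - x = - a *: (G + L *m y1) ->
  g *: (x - p) = - a *: (Gp + L *m y) ->
  y1 - y = (s * a) *: (L *m x + g *: (L *m (x - p))) ->
  fdot (x1 - xs) (x1 - xs) + s^-1 * fdot (y1 - ys) (y1 - ys) =
  fdot (x - xs) (x - xs) + s^-1 * fdot (y - ys) (y - ys)
  - 2 * a * fdot (G + L *m ys) (x - xs)
  - 2 * g * a * fdot (G + L *m ys) (x - p)
  - fdot (x1 - x) (x1 - x) - s^-1 * fdot (y1 - y) (y1 - y)
  - 2 * a * fdot (x1 - x) (G - Gp)
  - 2 * a * fdot (x1 - x) (L *m (y1 - y)).
Proof.
move=> s0 Lsym Lxs hu hs hd.
set u := x1 - x in hu *; set v := x - p in hs hd *; set w := y1 - y in hd *.
set b := x - xs; set z := y1 - ys; set q := G + L *m ys.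
have -> : x1 - xs = b + u by rewrite [RHS]addrC /b /u addrA subrK.
have -> : y - ys = z - w by rewrite /z /w opprB [RHS]addrC addrA subrK.
have hu' : u = - a *: (q + L *m z).
  by rewrite hu /q /z mulmxBr -addrA [L *m ys + _]addrC subrK.
have hw : s^-1 *: w = a *: (L *m b + g *: (L *m v)).
  rewrite hd /b [L *m (x - xs)]mulmxBr Lxs subr0 scalerA mulrA.
  by rewrite mulVf ?gt_eqF// mul1r.
have huv : u - g *: v = - a *: (G - Gp + L *m w).
  by rewrite hu hs -scalerBr /w mulmxBr opprD addrACA.
have adj A B : fdot (L *m A) B = fdot A (L *m B) by rewrite fdot_mulmxl Lsym.
clear hu hs hd; clearbody u v w b z q.
(* The claim is a combination of [e1] to [e4] with coefficients 2 or -2, hence the factor [g] in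
   [e2]; the products of [L *m z] with [b] and [v] in [e1] and [e2] cancel against [e4]. *)
have e1 := congr1 (fdot b) hu'.
have e2 := congr1 (fun A => g * fdot v A) hu'.
have e3 := congr1 (fdot u) huv.
have e4 := congr1 (fun A => fdot A z) hw.
move: e1 e2 e3 e4.
rewrite !(fdotDl, fdotDr, fdotZl, fdotZr, fdotNl, fdotNr) !adj.
rewrite (fdotC u b) (fdotC u v) (fdotC z w) (fdotC q b) (fdotC q v); lra.
Qed.

Unset Implicit Arguments.
Set Strict Implicit.

Theorem lemma2 (R : realType) (m d : nat)
  (f : 'I_m -> 'rV[R]_d -> R) (mu : R)
  (hmu : 0 <= mu)
  (hC1 : forall i, continuously_differentiable (f i))
  (hsmooth : forall i, locally_smooth (f i))
  (hconv : forall i, strongly_convex mu (f i))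
  (hmin : mu = 0 -> exists x, is_minimizer (average f) x)
  (e : rel 'I_m) (he : undirected_connected e)
  (W : 'M[R]_m) (hW : gossip_matrix e W) (hWpd : pos_def W)
  (L : 'M[R]_m) (hL : is_sqrt_mx (1%:M - W) L)
  (alpha sigma : nat -> R)
  (halpha : forall k, 0 < alpha k) (hsigma : forall k, 0 < sigma k)
  (Xm1 : 'M[R]_(m, d)) (X D Y : nat -> 'M[R]_(m, d)) :
  let gamma := stepsize_ratio alpha in
  let Xprev := lagged Xm1 X in
  D 0%N = 0 ->
  Y 0%N = 0 ->
  (forall k, D k.+1 = D k + (sigma k * alpha k) *:
      ((1%:M - W) *m ((1 + gamma k) *: X k - gamma k *: Xprev k))) ->
  (forall k, X k.+1 = X k - alpha k *: (grad_stackF f (X k) + D k.+1)) ->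
  (forall k, Y k.+1 = Y k + (sigma k * alpha k) *:
      ((1 + gamma k) *: (L *m X k) - gamma k *: (L *m Xprev k))) ->
  forall (Xs Ys : 'M[R]_(m, d)), saddle_point (lagrangian f L) Xs Ys ->
  forall (zeta : nat -> R), (forall k, 0 < zeta k) ->
  let Lk k := local_lipschitz_estimate f (X k) (Xprev k) in
  let gap k := primal_gap f L Xs Ys (X k) in
  let gap_prev k := primal_gap f L Xs Ys (Xprev k) in
  let V k :=
    fnorm (X k - Xs) ^+ 2
    + (sigma k)^-1 * fnorm (Y k - Ys) ^+ 2
    + 2^-1 * fnorm (X k - Xprev k) ^+ 2
    + 2 * gamma k * alpha k * gap_prev k in
  forall k,
  (k = 0%N -> X 0%N = Xm1 - alpha 0%N *: (grad_stackF f Xm1 + D 0%N)) ->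
  V k.+1 <=
    V k
    - (2^-1 - alpha k * Lk k - alpha k * zeta k) * fnorm (X k.+1 - X k) ^+ 2
    - (2^-1 - alpha k * Lk k) * fnorm (X k - Xprev k) ^+ 2
    - ((sigma k)^-1 - alpha k / zeta k) * fnorm (Y k.+1 - Y k) ^+ 2
    - (sigma k.+1 - sigma k) / (sigma k * sigma k.+1)
        * fnorm (Y k.+1 - Ys) ^+ 2
    - ((2 + 2 * gamma k) * alpha k - 2 * gamma k.+1 * alpha k.+1) * gap k.
Proof.
move=> gamma Xprev D0 Y0 hD hX hY Xs Ys hsad zeta hzeta Lk gap gap_prev V k h0.
have [[Lsym _] LL] := hL.
have Lxs := saddle_point_feasible hsad.
have DY j : D j = L *m Y j.
  elim: j => [|j IH]; first by rewrite D0 Y0 mulmx0.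
  rewrite hD hY IH -LL -mulmxA [RHS]mulmxDr.
  by rewrite !mulmxBr -!scalemxAr !mulmxBr -!scalemxAr.
have hprev : gamma k *: (X k - Xprev k)
    = - alpha k *: (grad_stackF f (Xprev k) + L *m Y k).
  (* At k = 0 the ratio is 1 and the relation is [h0]; at k = j + 1, gamma^k alpha^j = alpha^k
     rescales the previous update. *)
  rewrite -DY /gamma /Xprev; case: (k) h0 => [/(_ erefl) ->|j _] /=.
    by rewrite scale1r addrAC subrr add0r scaleNr.
  rewrite hX [_ - _ *: _]addrC addrK scalerN scalerA divfK ?gt_eqF//.
  by rewrite scaleNr.
have hx : X k.+1 - X k = - alpha k *: (grad_stackF f (X k) + L *m Y k.+1).
  by rewrite hX DY [_ - _ *: _]addrC addrK scaleNr.
have hy : Y k.+1 - Y k = (sigma k * alpha k) *: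
    (L *m X k + gamma k *: (L *m (X k - Xprev k))).
  rewrite hY [Y k + _]addrC addrK; congr (_ *: _).
  by rewrite mulmxBr scalerBr scalerDl scale1r addrA.
have := primal_dual_step Ys (hsigma k) Lsym Lxs hx hprev hy.
have a0 := halpha k.
have g0 : 0 < gamma k by rewrite /gamma; case: (k) => //= j; rewrite divr_gt0.
have df i x : differentiable (f i) x by have [] := hC1 i.
(* Taking Z = X^* yields -2 alpha^k gap^k, and Z = X^{k-1} yields -2 gamma^k alpha^k (gap^k -
   gap^{k-1}), whose last part is the gap term of V^k. *)
have sub Z := primal_gap_subgradient Xs Ys Z hmu hconv
  (fun i => df i (row i (X k))) Lsym.
have subs := ler_wpM2l (ltW a0) (sub Xs).
have subp := ler_wpM2l (ltW (mulr_gt0 g0 a0)) (sub (Xprev k)).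
have lip := ler_wpM2l (ltW a0)
  (local_lipschitz_young f (X k) (Xprev k) (X k.+1 - X k)).
have young := ler_wpM2l (ltW a0)
  (fdot_young (X k.+1 - X k) (L *m (Y k.+1 - Y k)) (hzeta k)).
have Lcontr n (A : 'M[R]_(m, n)) : fdot (L *m A) (L *m A) <= fdot A A.
  have := pos_def_fdot_ge0 A hWpd.
  by rewrite fdot_mulmxl Lsym mulmxA LL mulmxBl mul1mx fdotBr gerBl.
have az0 : 0 <= alpha k * (zeta k)^-1 by rewrite ltW// divr_gt0.
have {}Lcontr := ler_wpM2l az0 (Lcontr d (Y k.+1 - Y k)).
(* This term trades the weight 1/sigma^k of |Y^{k+1} - Y^*|^2 in the identity for the weight
   1/sigma^{k+1} in V^{k+1}. *)
have -> : (sigma k.+1 - sigma k) / (sigma k * sigma k.+1)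
    = (sigma k)^-1 - (sigma k.+1)^-1 by field; rewrite !gt_eqF.
have gaps0 : primal_gap f L Xs Ys Xs = 0 by rewrite /primal_gap subrr.
rewrite gaps0 in subs.
rewrite /V /gap_prev [Xprev k.+1]/= /gap /Lk !fnorm_sqr => step.
(* Of the -|X^{k+1} - X^k|^2 in the identity, one half pays for the new term of V^{k+1}; the other
   half remains in the bound. *)
lra.
Qed.
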